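(* Let $E\subset[0,1]$ be a Lebesgue measurable set with $\lambda(E)>0$, and let $f:[0,1]\to\mathbb{R}$ be a function with $f\in C^1[0,1]$. Then the following hold. 1. If $\lambda(\{x\in[0,1]: f'(x)=0\})=0$, then $\lambda(f(E))>0$. 2. If $f$ is not linear on any positive mass subset of $[0,1]$, then $\lambda(\operatorname{DQ}_f(E))>0$. In fact, for almost every $(x_1,x_2)\in(E\times E)\setminus D$ (with respect to two-dimensional Lebesgue measure), the number $\operatorname{DQ}_f(x_1,x_2)$ lies in the interior of $\operatorname{DQ}_f(E)$.
   Context: $\lambda$ denotes Lebesgue measure; a positive mass set is a Lebesgue measurable set of positive Lebesgue measure. Let $D=\{(x,x):0\le x\le 1\}$. For a function $g:[0,1]\to\mathbb{R}$ and $(x_1,x_2)\in([0,1]\times[0,1])\setminus D$, define $\operatorname{DQ}_g(x_1,x_2)=\frac{g(x_2)-g(x_1)}{x_2-x_1}$. For a set $F\subset[0,1]$ define $\operatorname{DQ}_g(F)=\{\operatorname{DQ}_g(x_1,x_2):(x_1,x_2)\in(F\times F)\setminus D\}\subset\mathbb{R}$. A function $f$ is linear on a set $S$ if there are real constants $a,b$ with $f(x)=ax+b$ for all $x\in S$. Interior is taken in $\mathbb{R}$. *)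

(* Defs.v *)
From HB Require Import structures.
From mathcomp Require Import all_boot all_order all_algebra.
From mathcomp Require Import all_classical all_reals all_analysis.

Set Implicit Arguments.
Unset Strict Implicit.
Unset Printing Implicit Defensive.

Import Order.TTheory GRing.Theory Num.Theory.
Import numFieldNormedType.Exports.

Local Open Scope classical_set_scope.
Local Open Scope ring_scope.

(* The library's [measurable] sets of [R] are the Borel sets; the Lebesgue
   measurable ones form the domain of [completed_lebesgue_measure], namely the
   Caratheodory sigma-algebra of the outer measure induced by interval length
   (see [completed_caratheodory_measurable]).  As a function,
   [completed_lebesgue_measure] is Lebesgue outer measure on every set. *)
Definition lebesgue_measurable (R : realType) (A : set R) : Prop :=
  ((wlength (@idfun R))^*%mu).-cara.-measurable A.

Definition positive_mass (R : realType) (A : set R) : Prop :=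
  lebesgue_measurable A /\ (0 < completed_lebesgue_measure A)%E.

Definition diag01 (R : realType) : set (R * R) :=
  [set p | 0 <= p.1 <= 1 /\ p.1 = p.2].

(* Functions on [0, 1] are represented by total functions [R -> R], of which
   only the values on [0, 1] are ever used. *)
Definition DQ (R : realType) (g : R -> R) (p : R * R) : R :=
  (g p.2 - g p.1) / (p.2 - p.1).

Definition DQ_set (R : realType) (g : R -> R) (F : set R) : set R :=
  DQ g @` ((F `*` F) `\` @diag01 R).

(* The limit is taken along points of [0, 1], so the derivative is one-sided
   at 0 and 1. *)
Definition derivable01 (R : realType) (f : R -> R) (x : R) : Prop :=
  cvg (DQ f (x, y) @[y --> within `[0, 1]%classic x^']).

Definition derive01 (R : realType) (f : R -> R) (x : R) : R :=
  lim (DQ f (x, y) @[y --> within `[0, 1]%classic x^']).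

Definition C1_01 (R : realType) (f : R -> R) : Prop :=
  (forall x, x \in `[0, 1] -> derivable01 f x) /\
  {within `[0, 1]%classic, continuous (derive01 f)}.

Definition linear_on (R : realType) (f : R -> R) (S : set R) : Prop :=
  exists a b : R, forall x, S x -> f x = a * x + b.

(* Main.v *)
Require Import Defs.
From HB Require Import structures.
From mathcomp Require Import all_boot all_order all_algebra.
From mathcomp Require Import all_classical all_reals all_analysis.
From mathcomp Require Import measurable_realfun.
From mathcomp Require Import ring lra.
Import Order.TTheory GRing.Theory Num.Theory.
Import numFieldNormedType.Exports.
Local Open Scope classical_set_scope.
Local Open Scope ring_scope.

Set Implicit Arguments.
Unset Strict Implicit.
Unset Printing Implicit Defensive.

(* Write g_t y = f y - t y, so that DQ f (y1, y2) = t iff g_t y1 = g_t y2.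
   Near a density point x of E with f'(x) != t0, every g_t with t close to t0
   is close to a linear map of nonzero slope, so the image under g_t of the
   part of E near x misses only a small proportion of an interval around g_t x:
   the image of the complement of E is small because g_t is Lipschitz.  For
   t0 = 0 this is part 1.  If x1, x2 are two such points and
   t0 = DQ f (x1, x2), the two intervals have almost the same centre, so the
   two images meet and every t close to t0 lies in DQ_set f E.  The pairs with
   DQ f (x1, x2) = f'(x1) form a null set by Fubini, since on each section f
   agrees with a tangent line; likewise for f'(x2). *)

(* [lebesgue_measure] is the Lebesgue outer measure on every set of reals, so
   monotonicity and subadditivity need no measurability. *)
Lemma le_lebesgue_outer (R : realType) (A B : set R) : A `<=` B ->
  (lebesgue_measure A <= lebesgue_measure B)%E.
Proof. exact: (@le_outer_measure _ _ (wlength (@idfun R))^*%mu). Qed.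

Lemma lebesgue_outerU2 (R : realType) (A B : set R) :
  (lebesgue_measure (A `|` B) <= lebesgue_measure A + lebesgue_measure B)%E.
Proof. exact: (@outer_measureU2 _ _ (wlength (@idfun R))^*%mu). Qed.

Lemma lebesgue_outer_bigcup (R : realType) (A : (set R)^nat) :
  (lebesgue_measure (\bigcup_n A n) <=
   \sum_(n <oo) lebesgue_measure (A n))%E.
Proof.
exact: (@outer_measure_sigma_subadditive _ _ (wlength (@idfun R))^*%mu).
Qed.

(** * Outer measure of intervals and of Lipschitz images *)

Lemma lebesgue_measure_itvcc (R : realType) (a b : R) : a <= b ->
  lebesgue_measure `[a, b]%classic = (b - a)%:E.
Proof.
rewrite lebesgue_measure_itv /= lte_fin le_eqVlt => /orP[/eqP->|->].
  by rewrite ltxx subrr.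
by rewrite EFinB.
Qed.

(** A cover of [S] by half-open intervals yields a cover of its image: the points of [S] in an
    interval of length [l] are sent within [K * l] of the value at any one of them. Centring at such
    a value costs the factor 2. *)
Lemma lebesgue_outer_lipschitz (R : realType) (g : R -> R) (S : set R) (K : R) :
  0 < K ->
  (forall x y, S x -> S y -> `|g x - g y| <= K * `|x - y|) ->
  (lebesgue_measure (g @` S) <= (2 * K)%:E * lebesgue_measure S)%E.
Proof.
move=> K0 gK; have K20 : 0 < 2 * K by rewrite mulr_gt0.
rewrite -lee_pdivrMl//; apply: le_ereal_inf_tmp => _ [C [mC SC] <-].
rewrite lee_pdivrMl//.
apply: (@le_trans _ _ (lebesgue_measure (\bigcup_n (g @` (S `&` C n))))).
  apply: le_lebesgue_outer => _ [x Sx <-].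
  by have [n _ Cnx] := SC _ Sx; exists n => //; exists x.
apply: (le_trans (lebesgue_outer_bigcup _)).
rewrite -nneseriesZl//.
apply: lee_nneseries => // n _.
move: (C n) (mC n) => D /ocitvP[->|[[a b] /= ab ->]].
  by rewrite setI0 image_set0 !measure0 mule0.
have [->|/set0P[x [Sx]]] := eqVneq (S `&` `]a, b]%classic) set0.
  by rewrite image_set0 measure0 mule_ge0// lee_fin ltW.
rewrite /= in_itv/= => /andP[ax xb].
apply: (@le_trans _ _ (lebesgue_measure
    `[g x - K * (b - a), g x + K * (b - a)]%classic)).
  apply: le_lebesgue_outer => _ [y [Sy +] <-].
  rewrite /= !in_itv/= => /andP[ay yb].
  rewrite -ler_distlC; apply: (le_trans (gK _ _ Sx Sy)).
  by rewrite ler_pM2l// ler_norml; apply/andP; split; lra.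
rewrite lebesgue_measure_itvcc; last first.
  have : 0 < K * (b - a) by rewrite mulr_gt0// subr_gt0.
  by lra.
rewrite wlength_itv/= lte_fin ab -EFinD -EFinM lee_fin.
by lra.
Qed.

Lemma lipschitz_within_continuous (R : realType) (g : R -> R) (I : set R)
    (K : R) :
  0 < K -> (forall x y, I x -> I y -> `|g x - g y| <= K * `|x - y|) ->
  {within I, continuous g}.
Proof.
move=> K0 gK; apply/subspace_continuousP => x Ix.
apply/(@cvgrPdist_le _ R R) => e e0.
have eK : 0 < e / K by rewrite divr_gt0.
apply: (@filterS _ (nbhs x) _ (fun y => `|x - y| <= e / K)).
  move=> y xy Iy.
  by rewrite (le_trans (gK _ _ Ix Iy))// mulrC -ler_pdivlMr.
by apply: (@cvgr_dist_le _ R R (nbhs x) _ id).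
Qed.

(** * Images that fill most of an interval *)

(** The intermediate value theorem gives each [v] of the target interval a preimage in
    [[x - r, x + r]]; if [v] is missed, that preimage lies outside [A]. So the missed values lie in
    the image of the complement of [A], and [g] is Lipschitz with constant [3 / 2 * |s|]. *)
Lemma lebesgue_outer_fill (R : realType) (g : R -> R) (A : set R) (x s r : R) :
  s != 0 -> 0 < r ->
  (forall y z, `[x - r, x + r]%classic y -> `[x - r, x + r]%classic z ->
    `|g y - g z - s * (y - z)| <= `|s| / 2 * `|y - z|) ->
  (lebesgue_measure
     (`[(g x - `|s| / 2 * r)%R, (g x + `|s| / 2 * r)%R]%classic `\`
      g @` (A `&` `[(x - r)%R, (x + r)%R]%classic)) <=
   (3 * `|s|)%:E *
   lebesgue_measure (`[(x - r)%R, (x + r)%R]%classic `\` A))%E.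
Proof.
move=> s0 r0 gs; have ns0 : 0 < `|s| by rewrite normr_gt0.
have gL y z : `[x - r, x + r]%classic y -> `[x - r, x + r]%classic z ->
    `|g y - g z| <= (3 / 2 * `|s|) * `|y - z|.
  move=> yI zI; have := gs _ _ yI zI.
  have := ler_normD (g y - g z - s * (y - z)) (s * (y - z)).
  rewrite subrK normrM; lra.
have -> : 3 * `|s| = 2 * (3 / 2 * `|s|) by lra.
have K0 : 0 < 3 / 2 * `|s| by rewrite !mulr_gt0.
apply: (le_trans _ (@lebesgue_outer_lipschitz _ g
  (`[x - r, x + r]%classic `\` A) _ K0 _)); last first.
  by move=> y z [yI _] [zI _]; exact: gL.
apply: le_lebesgue_outer => v [vJ vN].
have [|||c cI cv] := @IVT R g (x - r) (x + r) v.
- by lra.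
- exact: lipschitz_within_continuous K0 gL.
- have xm : `[x - r, x + r]%classic (x - r) by rewrite /= in_itv/= lexx/=; lra.
  have xp : `[x - r, x + r]%classic (x + r).
    by rewrite /= in_itv/= lexx/= andbT; lra.
  have xx : `[x - r, x + r]%classic x.
    by rewrite /= in_itv/=; apply/andP; split; lra.
  (* The values at the two endpoints lie on opposite sides of [g x], each at distance at least
     [|s| / 2 * r]; the sign of [s] decides which is the lower one. *)
  have := gs _ _ xm xx; have := gs _ _ xp xx.
  rewrite ge_min le_max !(addrC x) !addrK normrN (gtr0_norm r0) !ler_norml.
  move: vJ; rewrite /= in_itv/=.
  have [s1|s1|/eqP] := ltgtP s 0; last by rewrite (negPf s0).
  + rewrite (ltr0_norm s1) => /andP[v1 v2] /andP[a1 a2] /andP[b1 b2].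
    apply/andP; split; apply/orP; [right|left]; lra.
  + rewrite (gtr0_norm s1) => /andP[v1 v2] /andP[a1 a2] /andP[b1 b2].
    apply/andP; split; apply/orP; [left|right]; lra.
exists c => //; split => // Ac; apply: vN; exists c => //.
Qed.

(** Both points vary, so the bound survives the subtraction of [t * y] from [f y], with [a - t] in
    place of [a], and controls all chords in the interval. *)
Definition strict_derivative (R : realType) (f : R -> R) (x a : R) : Prop :=
  forall e, 0 < e -> \forall r \near 0^'+, forall y z,
    `[x - r, x + r]%classic y -> `[x - r, x + r]%classic z ->
    `|f y - f z - a * (y - z)| <= e * `|y - z|.

(** The outer measure of the complement makes sense for every [A], and the condition passes to
    larger sets. *)
Definition density_point (R : realType) (A : set R) (x : R) : Prop :=
  forall e, 0 < e -> \forall r \near 0^'+,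
    (lebesgue_measure (`[(x - r)%R, (x + r)%R]%classic `\` A) <=
     (e * r)%:E)%E.

Lemma near_right0_scale (R : realType) (P : R -> Prop) (c : R) : 0 < c ->
  (\forall r \near 0^'+, P r) -> \forall r \near 0^'+, P (c * r).
Proof.
move=> c0 [e /= e0 He]; exists (e / c); first by rewrite /= divr_gt0.
move=> r /=; rewrite sub0r normrN => re r0.
apply: He => /=; last by rewrite mulr_gt0.
by rewrite sub0r normrN normrM (gtr0_norm c0) mulrC -ltr_pdivlMr.
Qed.

(** The interval has length [4 * h], so at most an eighth of it is missed. The radius [2 * h] leaves
    room for moving the centre by [h] and still containing a fixed interval of radius [h]. *)
Definition nearly_fills (R : realType) (f : R -> R) (A : set R)
    (x d t h : R) : Prop :=
  (lebesgue_measure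
      (`[(f x - t * x - 2 * h)%R, (f x - t * x + 2 * h)%R]%classic `\`
       (fun y => f y - t * y)%R @` (A `&` `[(x - d)%R, (x + d)%R]%classic)) <=
     (h / 2)%:E)%E.

(** One scale [h] serves all [t] close to [t0]: half of the deviation [|s| / 2] allowed in
    [lebesgue_outer_fill] is spent on the strict derivative, the other half on replacing [t0] by
    [t]. *)
Lemma near_lebesgue_outer_fill (R : realType) (f : R -> R) (A : set R)
    (x a t0 d : R) :
  strict_derivative f x a -> density_point A x -> a != t0 -> 0 < d ->
  \forall h \near 0^'+, forall t, `|t - t0| <= `|a - t0| / 4 ->
    nearly_fills f A x d t h.
Proof.
move=> fx Ax at0 d0; set s := a - t0.
have s0 : s != 0 by rewrite subr_eq0.
have ns0 : 0 < `|s| by rewrite normr_gt0.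
have c0 : 0 < 4 / `|s| by rewrite divr_gt0.
have s40 : 0 < `|s| / 4 by rewrite divr_gt0.
(* The loss [3 * |s| * (r / 24)] is a quarter of [|s| / 2 * r = 2 * h], that is [h / 2]. *)
have e0 : 0 < 24^-1 :> R by rewrite invr_gt0.
near=> h => t tt0.
have h0 : 0 < h by near: h; exact: nbhs_right_gt.
pose r := 4 / `|s| * h.
have r0 : 0 < r by rewrite mulr_gt0.
have sr : `|s| / 2 * r = 2 * h by rewrite /r; field; rewrite gt_eqF.
have rd : r <= d.
  rewrite /r; near: h; apply: (near_right0_scale c0 (P := fun r => r <= d)).
  exact: nbhs_right_le.
have fr : forall y z,
    `[x - r, x + r]%classic y -> `[x - r, x + r]%classic z ->
    `|f y - f z - a * (y - z)| <= `|s| / 4 * `|y - z|.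
  rewrite /r; near: h.
  exact: (near_right0_scale c0 (fx _ s40)).
have Ar : (lebesgue_measure (`[(x - r)%R, (x + r)%R]%classic `\` A) <=
     (24^-1 * r)%:E)%E.
  rewrite /r; near: h.
  exact: (near_right0_scale c0 (Ax _ e0)).
have gr y z : `[x - r, x + r]%classic y -> `[x - r, x + r]%classic z ->
    `|f y - t * y - (f z - t * z) - s * (y - z)| <= `|s| / 2 * `|y - z|.
  move=> yI zI; have := fr _ _ yI zI.
  have -> : f y - t * y - (f z - t * z) - s * (y - z) =
    f y - f z - a * (y - z) - (t - t0) * (y - z) by rewrite /s; ring.
  have := ler_normB (f y - f z - a * (y - z)) ((t - t0) * (y - z)).
  have : `|t - t0| * `|y - z| <= `|s| / 4 * `|y - z| by rewrite ler_wpM2r.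
  rewrite normrM; lra.
have := lebesgue_outer_fill A s0 r0 gr; rewrite sr => fill.
apply: (@le_trans _ _ ((3 * `|s|)%:E * (24^-1 * r)%:E)%E).
  apply: le_trans (le_trans fill _); last first.
    by rewrite lee_pmul2l// lte_fin mulr_gt0.
  apply: le_lebesgue_outer => v [vJ vN]; split => // -[y [Ay yI] yv].
  apply: vN; exists y => //; split => //.
  by move: yI; rewrite /= !in_itv/= => /andP[y1 y2]; apply/andP; split; lra.
rewrite -EFinM lee_fin.
have -> : 3 * `|s| * (24^-1 * r) = 4^-1 * (`|s| / 2 * r) by field.
rewrite sr; lra.
Unshelve. all: by end_near. Qed.

(** * Interior points of the set of difference quotients *)

Lemma interior_DQ_set (R : realType) (f : R -> R) (A : set R)
    (x1 x2 a1 a2 : R) : x1 != x2 ->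
  strict_derivative f x1 a1 -> strict_derivative f x2 a2 ->
  density_point A x1 -> density_point A x2 ->
  a1 != DQ f (x1, x2) -> a2 != DQ f (x1, x2) ->
  interior (DQ_set f A) (DQ f (x1, x2)).
Proof.
move=> x12 fx1 fx2 Ax1 Ax2; set t0 := DQ f (x1, x2) => at1 at2.
have x21 : x2 - x1 != 0 by rewrite subr_eq0 eq_sym.
have vE : f x2 - t0 * x2 = f x1 - t0 * x1.
  by rewrite /t0 /DQ /=; field.
(* A third of the distance keeps the intervals of radius [d] around [x1] and [x2] disjoint, so
   points found in them are distinct. *)
pose d := `|x2 - x1| / 3.
have d0 : 0 < d by rewrite divr_gt0// normr_gt0.
have [h [h0 H1 H2]] : exists h, [/\ 0 < h,
   forall t, `|t - t0| <= `|a1 - t0| / 4 -> nearly_fills f A x1 d t h &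
   forall t, `|t - t0| <= `|a2 - t0| / 4 -> nearly_fills f A x2 d t h].
  apply: (@filter_ex _ (0 : R)^'+); near=> h; split.
  - by near: h; exact: nbhs_right_gt.
  - by near: h; exact: near_lebesgue_outer_fill.
  - by near: h; exact: near_lebesgue_outer_fill.
have near_t0 (e : R) : 0 < e -> \forall t \near t0, `|t - t0| <= e.
  move=> e0; apply: (@filterS _ (nbhs t0) _ (fun t => `|t0 - t| <= e)).
    by move=> t; rewrite distrC.
  by apply: (@cvgr_dist_le _ R R (nbhs t0) _ id).
have q1 : 0 < `|a1 - t0| / 4 by rewrite divr_gt0// normr_gt0 subr_eq0.
have q2 : 0 < `|a2 - t0| / 4 by rewrite divr_gt0// normr_gt0 subr_eq0.
(* Within this distance of [t0], changing [t0] to [t] moves each of the two centres by at most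
   [h]. *)
have q3 : 0 < h / (1 + `|x1| + `|x2|).
  by rewrite divr_gt0// -addrA ltr_wpDr// addr_ge0.
rewrite /interior /=; near=> t.
have tx : `|t - t0| * (1 + `|x1| + `|x2|) <= h.
  rewrite -ler_pdivlMr; last by rewrite -addrA ltr_wpDr// addr_ge0.
  by near: t; exact: near_t0.
have t1 : `|(t - t0) * x1| <= h.
  rewrite normrM; apply: le_trans tx; rewrite ler_wpM2l//.
  by rewrite addrAC ler_wpDl// addr_ge0.
have t2 : `|(t - t0) * x2| <= h.
  rewrite normrM; apply: le_trans tx; rewrite ler_wpM2l//.
  by rewrite ler_wpDl// addr_ge0.
have /H1 {}H1 : `|t - t0| <= `|a1 - t0| / 4 by near: t; exact: near_t0.
have /H2 {}H2 : `|t - t0| <= `|a2 - t0| / 4 by near: t; exact: near_t0.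
apply: contrapT => tN.
pose v := f x1 - t0 * x1.
(* A value [w] taken by both images would be [f y1 - t * y1 = f y2 - t * y2], making [t] a
   difference quotient. So each [w] is missed by one image, and an interval of length [2 * h] has
   measure at most [h]. *)
have : (lebesgue_measure `[(v - h)%R, (v + h)%R]%classic <=
    (h / 2)%:E + (h / 2)%:E)%E.
  apply: le_trans (leeD H1 H2) => //.
  apply: le_trans (lebesgue_outerU2 _ _).
  apply: le_lebesgue_outer => w; rewrite /= in_itv/= => /andP[w1 w2].
  apply: contrapT => /not_orP[/not_andP[] + /not_andP[]].
  - move=> W1; exfalso; apply: W1.
    rewrite /= in_itv/=; move: t1 w1 w2; rewrite ler_norml /v.
    by move=> /andP[? ?] ? ?; apply/andP; split; lra.
  - move=> W1; exfalso; apply: W1.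
    rewrite /= in_itv/=; move: t1 w1 w2; rewrite ler_norml /v.
    by move=> /andP[? ?] ? ?; apply/andP; split; lra.
  - move=> _ W2; exfalso; apply: W2.
    rewrite /= in_itv/=; move: t2 w1 w2; rewrite ler_norml /v.
    by move=> /andP[? ?] ? ?; apply/andP; split; lra.
  - move=> /contrapT[y1 [Ay1 y1I] y1w] /contrapT[y2 [Ay2 y2I] y2w].
    have y12 : y2 - y1 != 0.
      apply/negP; rewrite subr_eq0 => /eqP y12.
      move: y1I y2I; rewrite /= !in_itv/= y12 => /andP[? ?] /andP[? ?].
      have : `|x2 - x1| <= d + d by rewrite ler_norml; apply/andP; split; lra.
      have : 0 < `|x2 - x1| by rewrite normr_gt0.
      by rewrite /d; lra.
    apply: tN; exists (y1, y2).
      split => //= -[_] /= y12E; move: y12.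
      by rewrite y12E subrr eqxx.
    apply: (mulIf y12); rewrite /DQ /= divfK//.
    by move: y1w y2w => <- /eqP; rewrite -subr_eq0 => /eqP ?; lra.
rewrite lebesgue_measure_itvcc; last by lra.
rewrite -EFinD lee_fin; lra.
Unshelve. all: by end_near. Qed.

(** * Density points and Borel approximation *)

Lemma ae_density_point (R : realType) (A : set R) : measurable A ->
  exists N : set R, [/\ measurable N, lebesgue_measure N = 0%E &
    forall x, A x -> ~ N x -> density_point A x].
Proof.
move=> mA; have [N [mN N0 AN]] := lebesgue_density mA.
exists N; split=> // x Ax Nx e e0.
have Hx : (lebesgue_measure (A `&` ball x r) / lebesgue_measure (ball x r))%E
    @[r --> 0^'+] --> (\1_A x)%:E.
  by apply: contrapT => /AN.
rewrite indicE mem_set//= in Hx.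
(* A ball of radius [r] has length [2 * r], so a missing proportion [e / 2] amounts to [e * r]. *)
have nb : nbhs (1%:E : \bar R) [set y : \bar R | ((1 - e / 2)%:E < y)%E].
  apply: open_nbhs_nbhs; split; first exact: open_ereal_gt_ereal.
  by rewrite /= lte_fin ltrBlDr ltrDl divr_gt0.
have {}Hx := Hx _ nb.
near=> r.
have r0 : 0 < r by near: r; exact: nbhs_right_gt.
have : ((1 - e / 2)%:E <
    lebesgue_measure (A `&` ball x r) / lebesgue_measure (ball x r))%E.
  by near: r.
rewrite lebesgue_measure_ball ?(ltW r0)// -[r *+ 2]mulr_natr.
rewrite inver gt_eqF ?mulr_gt0// lte_pdivlMr ?mulr_gt0// => Ar.
have xr : lebesgue_measure `[(x - r)%R, (x + r)%R]%classic = (r * 2)%:E.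
  by rewrite lebesgue_measure_itvcc; [congr EFin; ring|lra].
rewrite measureD//; last by rewrite [ltLHS]xr ltry.
rewrite [X in (X - _)%E]xr.
set m := (X in (_ - X <= _)%E).
have : (lebesgue_measure (A `&` ball x r) <= m)%E.
  apply: le_lebesgue_outer => y [Ay]; rewrite ball_itv /= => yr; split => //.
  by move: yr; rewrite /= !in_itv/= => /andP[? ?]; rewrite !ltW.
move=> /(lt_le_trans Ar); clearbody m.
case: m => [m| |]; rewrite -?EFinM ?lte_fin//=.
- by move=> rm; rewrite -EFinB lee_fin; lra.
- by move=> _; rewrite addeNy leNye.
Unshelve. all: by end_near. Qed.

(** The Caratheodory sigma-algebra is the completion of the Borel one, whose members are Borel sets
    enlarged by subsets of Borel null sets. *)
Lemma lebesgue_measurable_inner (R : realType) (E : set R) :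
  lebesgue_measurable E ->
  exists A N : set R, [/\ measurable A, measurable N, lebesgue_measure N = 0%E,
    A `<=` E & E `<=` A `|` N].
Proof.
rewrite /lebesgue_measurable -completed_caratheodory_measurable.
rewrite g_sigma_completed_algebra_genE => -[A mA [N0 [N [mN N00 NN]] <-]].
exists A, N; split => //.
exact: setUS.
Qed.

(** * Continuously differentiable functions at interior points *)

(** Small increments from an interior point stay in [[0, 1]], so the limit within the interval is a
    two-sided one. *)
Lemma C1_01_is_derive (R : realType) (f : R -> R) (x : R) :
  C1_01 f -> 0 < x < 1 -> is_derive x 1 f (derive01 f x).
Proof.
move=> [fd _] /andP[x0 x1].
have xI : x \in `[0, 1] by rewrite in_itv/= !ltW.
have fx : DQ f (x, y) @[y --> within `[0, 1]%classic x^'] --> derive01 f x.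
  exact: fd.
suff H : (fun h => h^-1 *: ((f \o shift x) (h *: 1) - f x)) @ 0^' -->
    derive01 f x.
  by apply: DeriveDef; [apply/cvg_ex; exists (derive01 f x)|exact: cvg_lim].
apply/(@cvgrPdist_le _ R R) => e e0.
have [d /= d0 Hd] := @cvgr_dist_le _ R R _ _ _ _ fx e e0.
near=> h.
have h0 : h != 0 by near: h; exact: nbhs_dnbhs_neq.
have hd : `|h| < Num.min d (Num.min x (1 - x)).
  near: h; apply: dnbhs0_lt.
  by rewrite !lt_min d0 x0 subr_gt0.
move: hd; rewrite !lt_min => /and3P[hd hx hx1].
have /= := Hd (h + x).
rewrite opprD addrCA subrr addr0 normrN => /(_ hd).
rewrite -subr_eq0 addrK => /(_ h0).
have hxI : h + x \in `[0, 1].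
  rewrite in_itv/=; move: hx hx1; rewrite !ltr_norml => /andP[? ?] /andP[? ?].
  by apply/andP; split; lra.
move=> /(_ hxI); rewrite /DQ /= addrK.
have -> // : h^-1 *: (f (h%:A + x) - f x) = (f (h + x) - f x) / h.
by rewrite -[h%:A]/(h * 1) mulr1 mulrC.
Unshelve. all: by end_near. Qed.

Lemma C1_01_continuous (R : realType) (f : R -> R) (x : R) :
  C1_01 f -> 0 < x < 1 -> {for x, continuous f}.
Proof.
move=> fC x01; have fx := C1_01_is_derive fC x01.
by apply/differentiable_continuous/derivable1_diffP.
Qed.

Lemma C1_01_derive01_continuous (R : realType) (f : R -> R) (x : R) :
  C1_01 f -> 0 < x < 1 -> {for x, continuous (derive01 f)}.
Proof.
move=> [_ cf] x01.
have oc : (`]0, 1[%classic : set R) `<=` `[0, 1]%classic.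
  exact: subset_itv_oo_cc.
have := continuous_subspaceW oc cf.
rewrite continuous_open_subspace; last exact: interval_open.
by apply; rewrite inE/= in_itv.
Qed.

(** The mean value theorem writes the chord slope as [derive01 f c] with [c] between [z] and [y],
    and [derive01 f] is continuous at [x]. *)
Lemma C1_01_strict_derivative (R : realType) (f : R -> R) (x : R) :
  C1_01 f -> 0 < x < 1 -> strict_derivative f x (derive01 f x).
Proof.
move=> fC x01 e e0.
have [d /= d0 Hd] :=
  @cvgr_dist_le _ R R _ _ _ _ (C1_01_derive01_continuous fC x01) _ e0.
case/andP: x01 => x0 x1.
near=> r => y z.
have r0 : 0 < r by near: r; exact: nbhs_right_gt.
have rd : r < d by near: r; exact: nbhs_right_lt.
have rx : r < x by near: r; exact: nbhs_right_lt.
have rx1 : r < 1 - x by near: r; apply: nbhs_right_lt; rewrite subr_gt0.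
wlog zy : y z / z <= y => [wl yI zI|].
  have [zy|/ltW yz] := leP z y; first exact: wl.
  rewrite [X in X <= _](_ : _ =
    `|f z - f y - derive01 f x * (z - y)|) ?(distrC y); first exact: wl.
  by rewrite -normrN; congr (`| _ |); ring.
rewrite /= !in_itv/= => /andP[y1 y2] /andP[z1 z2].
have fD c : c \in `[z, y] -> 0 < c < 1.
  by rewrite in_itv/= => /andP[? ?]; apply/andP; split; lra.
have [||c cI ->] := @MVT_segment _ f (derive01 f) z y zy.
- by move=> c /subset_itv_oo_cc/fD; exact: C1_01_is_derive.
- apply: continuous_in_subspaceT => c; rewrite inE/= => /fD.
  exact: C1_01_continuous.
rewrite -mulrBl normrM ler_wpM2r// distrC; apply: Hd => /=.
move: cI; rewrite in_itv/= => /andP[? ?].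
by rewrite ltr_norml; apply/andP; split; lra.
Unshelve. all: by end_near. Qed.

(** * Measurability and null sets in the plane *)

(** Extended by 0 outside [U], both functions are Borel on the whole line; the set is then the part
    of a Borel zero set inside [U * U]. *)
Lemma measurable_tangent_set (R : realType) (f g : R -> R) (U : set R) :
  open U -> {in U, continuous f} -> {in U, continuous g} ->
  measurable [set p : R * R | [/\ U p.1, U p.2 &
    f p.2 - f p.1 = g p.1 * (p.2 - p.1)]].
Proof.
move=> oU cf cg; have mU : measurable U by exact: open_measurable.
have mf : measurable_fun setT (f \_ U).
  apply/(measurable_restrictT _ mU).
  apply: subspace_continuous_measurable_fun => //.
  by rewrite continuous_open_subspace.
have mg : measurable_fun setT (g \_ U).
  apply/(measurable_restrictT _ mU).
  apply: subspace_continuous_measurable_fun => //.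
  by rewrite continuous_open_subspace.
pose h (p : R * R) := (f \_ U) p.2 - (f \_ U) p.1 - (g \_ U) p.1 * (p.2 - p.1).
have mh : measurable_fun setT h.
  apply: measurable_funB.
    apply: measurable_funB.
      exact: measurableT_comp.
    exact: measurableT_comp.
  apply: measurable_funM; first exact: measurableT_comp.
  exact: measurable_funB.
rewrite [X in measurable X](_ : _ = (U `*` U) `&` h @^-1` [set 0]).
  apply: measurableI; first exact: measurableX.
  by rewrite -[X in measurable X]setTI; exact: mh.
apply/seteqP; split => [[x y] /= [Ux Uy fxy]|[x y] /= [[Ux Uy]]].
  by split => //; rewrite /h /= !patchE !mem_set// fxy subrr.
by rewrite /h /= !patchE !mem_set// => /subr0_eq.
Qed.

Lemma nbhs_lebesgue_measure_gt0 (R : realType) (S : set R) (t : R) :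
  nbhs t S -> (0 < lebesgue_measure S)%E.
Proof.
move=> /nbhs_ballP[e /= e0 eS].
apply: (lt_le_trans _ (le_lebesgue_outer eS)).
by rewrite lebesgue_measure_ball ?(ltW e0)// lte_fin pmulrn_lgt0.
Qed.

Lemma product_measure_xsection0 (R : realType) (B : set (R * R)) :
  (forall x, lebesgue_measure (xsection B x) = 0%E) ->
  (@lebesgue_measure R \x @lebesgue_measure R)%E B = 0%E.
Proof.
move=> B0; rewrite /product_measure1.
apply: integral0_eq => x _; exact: B0.
Qed.

(** The product measure is defined by integrating over x-sections; uniqueness identifies it with the
    one that integrates over y-sections. *)
Lemma product_measure_ysection0 (R : realType) (B : set (R * R)) :
  measurable B -> (forall y, lebesgue_measure (ysection B y) = 0%E) ->
  (@lebesgue_measure R \x @lebesgue_measure R)%E B = 0%E.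
Proof.
move=> mB B0.
rewrite (@product_measure_unique _ _ _ _ _ _ _
  (@lebesgue_measure R \x^ @lebesgue_measure R)%E)//.
- by rewrite /= /product_measure2; apply: integral0_eq => y _; exact: B0.
- by move=> X Y mX mY; exact: product_measure2E.
Qed.

(** * Exceptional points and exceptional pairs *)

(** [N] collects the null remainder of [E] outside [A], the exceptional points of the density
    theorem for [A], and the endpoints 0 and 1. Density is obtained for the Borel set [A] and
    inherited by [E]. *)
Lemma lebesgue_density_set (R : realType) (E : set R) :
  E `<=` `[0, 1]%classic -> lebesgue_measurable E ->
  exists A N : set R, [/\ measurable A, measurable N & lebesgue_measure N = 0%E]
    /\ [/\ A `<=` E, E `<=` A `|` N &
      forall x, A x -> ~ N x -> 0 < x < 1 /\ density_point E x].
Proof.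
move=> E01 /lebesgue_measurable_inner[A [N [mA mN N0 AE EAN]]].
have [M [mM M0 AM]] := ae_density_point mA.
pose P := [set 0; 1] : set R.
have mP : measurable P by exact: measurableU.
have P0 : lebesgue_measure P = 0%E.
  by apply: countable_lebesgue_measure0; apply: finite_set_countable;
    rewrite finite_setU; split; exact: finite_set1.
have mNMP : measurable (N `|` M `|` P) by do 2?apply: measurableU.
exists A, (N `|` M `|` P); split; split => //.
- apply/eqP; rewrite eq_le measure_ge0 andbT.
  apply: le_trans (lebesgue_outerU2 _ _) _.
  rewrite [X in (_ + X)%E]P0 adde0.
  by apply: le_trans (lebesgue_outerU2 _ _) _; rewrite N0 M0 adde0.
- by move=> x /EAN[]; [left|right; left; left].
- move=> x Ax /not_orP[/not_orP[_ Mx] /not_orP[x0 x1]]; split.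
    have := E01 _ (AE _ Ax); rewrite /= in_itv/= !le_eqVlt eq_sym.
    by move=> /andP[/orP[/eqP//|->] /orP[/eqP//|->]].
  move=> e e0; have := AM _ Ax Mx e e0.
  apply: filterS => r; apply: le_trans; apply: le_lebesgue_outer.
  by move=> y [? Ey]; split => // /AE.
Qed.

(** The slope equation is multiplied out, so the set contains the diagonal of the open square and a
    pair of interior points outside it has distinct coordinates. *)
Definition tangent_set (R : realType) (f : R -> R) : set (R * R) :=
  [set p | [/\ `]0, 1[%classic p.1, `]0, 1[%classic p.2 &
    f p.2 - f p.1 = derive01 f p.1 * (p.2 - p.1)]].

Lemma measurable_C1_tangent_set (R : realType) (f : R -> R) :
  C1_01 f -> measurable (tangent_set f).
Proof.
move=> fC; apply: measurable_tangent_set; first exact: interval_open.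
  by move=> x; rewrite inE /= in_itv; exact: C1_01_continuous.
by move=> x; rewrite inE /= in_itv; exact: C1_01_derive01_continuous.
Qed.

(* On a section of the tangent set, [f] agrees with a tangent line. *)
Lemma tangent_set_xsection0 (R : realType) (f : R -> R) : C1_01 f ->
  (forall S : set R, S `<=` `[0, 1]%classic -> positive_mass S ->
    ~ linear_on f S) ->
  forall x, lebesgue_measure (xsection (tangent_set f) x) = 0%E.
Proof.
move=> fC fN x; apply/eqP; rewrite eq_le measure_ge0 andbT leNgt.
apply/negP => S0; apply: (fN (xsection (tangent_set f) x)).
- move=> y /xsectionP[_ /= + _]; rewrite /= !in_itv/=.
  by move=> /andP[? ?]; rewrite !ltW.
- split; last exact: S0.
  apply: sub_caratheodory.
  have := @measurable_xsection _ _ R R _ x (measurable_C1_tangent_set fC).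
  by [].
- exists (derive01 f x), (f x - derive01 f x * x) => y /xsectionP[/= _ _ fy].
  by move: fy => /eqP; rewrite subr_eq => /eqP ->; ring.
Qed.

(** Excluding [(x, y)] makes the chord slope differ from the derivative at [x]; since the slope is
    symmetric, excluding [(y, x)] does the same at [y]. *)
Lemma interior_DQ_set_C1 (R : realType) (f : R -> R) (E : set R) (x y : R) :
  C1_01 f -> 0 < x < 1 -> 0 < y < 1 -> density_point E x -> density_point E y ->
  ~ tangent_set f (x, y) -> ~ tangent_set f (y, x) ->
  interior (DQ_set f E) (DQ f (x, y)).
Proof.
move=> fC x01 y01 Ex Ey xyN yxN.
have xy : x != y.
  apply/eqP => xy; apply: xyN; rewrite -xy; split; rewrite /= ?in_itv//=.
  by rewrite !subrr mulr0.
have yx0 : y - x != 0 by rewrite subr_eq0 eq_sym.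
apply: (@interior_DQ_set _ _ _ _ _ (derive01 f x) (derive01 f y)) => //.
- exact: C1_01_strict_derivative.
- exact: C1_01_strict_derivative.
- apply/eqP => fx; apply: xyN; split; rewrite /= ?in_itv//=.
  by rewrite fx /DQ /= divfK.
- apply/eqP => fx; apply: yxN; split; rewrite /= ?in_itv//=.
  by rewrite fx /DQ /=; field.
Qed.

(** * Positive measure of the image and of the set of difference quotients *)

Theorem theorem1p2 (R : realType) (E : set R) (f : R -> R)
    (hE01 : E `<=` `[0, 1]%classic)
    (hEmeas : lebesgue_measurable E)
    (hEpos : (0 < completed_lebesgue_measure E)%E)
    (hf : C1_01 f) :
  (completed_lebesgue_measure
       [set x : R | x \in `[0, 1] /\ derive01 f x = 0] = 0%E ->
     (0 < completed_lebesgue_measure (f @` E))%E)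
  /\
  ((forall S : set R, S `<=` `[0, 1]%classic -> positive_mass S ->
       ~ linear_on f S) ->
     (0 < completed_lebesgue_measure (DQ_set f E))%E
     /\
     {ae (@lebesgue_measure R \x @lebesgue_measure R)%E,
       forall p : R * R, ((E `*` E) `\` @diag01 R) p ->
         interior (DQ_set f E) (DQ f p)}).
Proof.
have [A [N [[mA mN N0] [AE EAN good]]]] := lebesgue_density_set hE01 hEmeas.
have A0 : (0 < lebesgue_measure A)%E.
  apply: (lt_le_trans hEpos); apply: le_trans (le_lebesgue_outer EAN) _.
  by apply: le_trans (lebesgue_outerU2 _ _) _; rewrite N0 adde0.
split=> [Z0|fN].
  (* Otherwise [A], which has positive measure, would be covered by two null sets. *)
  have [x [Ax Nx fx]] : exists x, [/\ A x, ~ N x & derive01 f x != 0].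
    apply: contrapT => AN.
    have : A `<=` N `|` [set x : R | x \in `[0, 1] /\ derive01 f x = 0].
      move=> x Ax; have [|Nx] := pselect (N x); first by left.
      right; split; first exact: hE01 (AE _ Ax).
      by apply/eqP/negPn/negP => fx; apply: AN; exists x.
    move=> /le_lebesgue_outer/(lt_le_trans A0).
    move=> /lt_le_trans/(_ (lebesgue_outerU2 _ _)).
    by rewrite N0 add0e [X in (_ < X)%E]Z0 ltxx.
  have [x01 Ex] := good x Ax Nx.
  (* For [t = 0] the tilted map is [f] itself; the radius 1 is arbitrary. If [f] sent [E] to a null
     set, an interval of length [4 * h] would have measure at most [h / 2]. *)
  have [h [h0]] : exists h, 0 < h /\ forall t,
      `|t - 0| <= `|derive01 f x - 0| / 4 -> nearly_fills f E x 1 t h.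
    apply: (@filter_ex _ (0 : R)^'+); near=> h; split.
      by near: h; exact: nbhs_right_gt.
    near: h; apply: near_lebesgue_outer_fill => //.
    exact: C1_01_strict_derivative.
  have q0 : `|0 - 0 : R| <= `|derive01 f x - 0| / 4.
    by rewrite subrr normr0 divr_ge0.
  move=> /(_ 0 q0) fill; rewrite lt0e measure_ge0 andbT; apply/eqP => fE0.
  have : (lebesgue_measure
      `[(f x - 0 * x - 2 * h)%R, (f x - 0 * x + 2 * h)%R]%classic <=
      lebesgue_measure (f @` E) + (h / 2)%:E)%E.
    apply: le_trans (leeD (lexx _) fill).
    apply: le_trans (lebesgue_outerU2 _ _); apply: le_lebesgue_outer => v vI.
    have [|vN] := pselect ((f @` E) v); first by left.
    right; split => // -[y [Ey _]]; rewrite mul0r subr0 => yv.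
    by apply: vN; exists y.
  rewrite [X in (X + _)%E]fE0 add0e lebesgue_measure_itvcc; last lra.
  by rewrite lee_fin; lra.
pose B := tangent_set f.
pose B' := [set p : R * R | B (p.2, p.1)].
(* The exceptional pairs: a coordinate in [N], or a chord tangent to the graph at its first or
   second point. *)
pose N2 := (N `*` setT) `|` (setT `*` N) `|` (B `|` B').
have mB : measurable B by exact: measurable_C1_tangent_set.
have mB' : measurable B'.
  rewrite -[X in measurable X]setTI.
  exact: (@measurable_swap _ _ R R measurableT _ mB).
have B0 := product_measure_xsection0 (tangent_set_xsection0 hf fN).
have B'0 : (@lebesgue_measure R \x @lebesgue_measure R)%E B' = 0%E.
  apply: product_measure_ysection0 => // y.
  (* Swapping coordinates turns tangency at the second point into tangency at the first, so the
     y-sections of [B'] are x-sections of [B]. *)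
  rewrite (_ : ysection B' y = xsection B y).
    exact: tangent_set_xsection0.
  by apply/seteqP; split => z /=; rewrite /xsection /ysection /= !inE.
have mN2 : measurable N2.
  by apply: measurableU; apply: measurableU => //; exact: measurableX.
have N20 : (@lebesgue_measure R \x @lebesgue_measure R)%E N2 = 0%E.
  have mNT : measurable (N `*` [set: R]) by exact: measurableX.
  have mTN : measurable ([set: R] `*` N) by exact: measurableX.
  have NT0 : (@lebesgue_measure R \x @lebesgue_measure R)%E (N `*` setT) = 0%E.
    by rewrite product_measure1E// [X in (X * _)%E]N0 mul0e.
  have TN0 : (@lebesgue_measure R \x @lebesgue_measure R)%E (setT `*` N) = 0%E.
    by rewrite product_measure1E// [X in (_ * X)%E]N0 mule0.
  by rewrite !null_set_setU//; apply: measurableU.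
have N2good x y : E x -> E y -> ~ N2 (x, y) ->
    interior (DQ_set f E) (DQ f (x, y)).
  move=> Ex Ey /not_orP[/not_orP[Nx Ny] /not_orP[Bxy Byx]].
  have NNx : ~ N x by move=> ?; apply: Nx.
  have NNy : ~ N y by move=> ?; apply: Ny.
  have [x01 dx] : 0 < x < 1 /\ density_point E x.
    by have [Ax|//] := EAN _ Ex; exact: good.
  have [y01 dy] : 0 < y < 1 /\ density_point E y.
    by have [Ay|//] := EAN _ Ey; exact: good.
  exact: interior_DQ_set_C1.
split; last first.
  exists N2; split => // -[x y] /= xyN; apply: contrapT => xyN2; apply: xyN.
  by move=> [[Ex Ey] _]; exact: N2good.
(* [A * A] has positive product measure and cannot lie in the null set [N2]. One good pair suffices:
   a set with an interior point has positive measure. *)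
have [[x y] [[Ax Ay] xyN2]] : exists p, (A `*` A) p /\ ~ N2 p.
  apply: contrapT => AN2.
  have AAN2 : A `*` A `<=` N2.
    by move=> p AAp; apply: contrapT => pN2; apply: AN2; exists p.
  have mAA : measurable (A `*` A) by exact: measurableX.
  have := @le_measure _ _ _ (@lebesgue_measure R \x @lebesgue_measure R)%E
    (A `*` A) N2.
  rewrite !inE => /(_ mAA mN2 AAN2).
  by rewrite [X in (_ <= X)%E]N20 [X in (X <= _)%E]product_measure1E// leNgt
    mule_gt0.
apply: (@nbhs_lebesgue_measure_gt0 _ _ (DQ f (x, y))).
by apply: N2good => //; exact: AE.
Unshelve. all: by end_near. Qed.
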